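(* Let $S,T,P$ and $Q$ be $n\times n$ complex matrices. Then $$\begin{aligned}\mathbf{ber}^2\left(\begin{bmatrix}S&P\\Q&T\end{bmatrix}\right)\leq{}&\max\left\{\mathbf{ber}^2(S),\mathbf{ber}^2(T)\right\}\\&+\max\left\{\mathbf{ber}(S),\mathbf{ber}(T)\right\}\cdot\max\left\{\mathbf{ber}\big(|Q|^2+P(|P|^2)^\dagger P^*\big),\mathbf{ber}\big(|P|^2+Q(|Q|^2)^\dagger Q^*\big)\right\}\\&+\frac14\max\left\{\left\||Q|^2+|P^*|^2\right\|_{\mathbf{ber}},\left\||P|^2+|Q^*|^2\right\|_{\mathbf{ber}}\right\}+\frac12\max\left\{\mathbf{ber}(PQ),\mathbf{ber}(QP)\right\}.\end{aligned}$$
   Context: $T^*$ is the adjoint, $|T|=\sqrt{T^*T}$ (so $|T|^2=T^*T$), and $T^\dagger$ is the Moore–Penrose inverse. $\mathbb{C}^n$ with its standard inner product is regarded as a reproducing kernel Hilbert space of functions on $\{1,\dots,n\}$; its reproducing kernels are the standard basis vectors $e_1,\dots,e_n$. Thus for an $n\times n$ matrix $T$, the Berezin number is $\mathbf{ber}(T)=\max_{j}|\langle Te_j,e_j\rangle|$ and the Berezin norm is $\|T\|_{\mathbf{ber}}=\max_{i,j}|\langle Te_i,e_j\rangle|$. The direct sum $\mathbb{C}^n\oplus\mathbb{C}^n$ is regarded as a reproducing kernel Hilbert space on the product set $\{1,\dots,n\}\times\{1,\dots,n\}$, the reproducing kernel at $(i,j)$ being $(e_i,e_j)$, with normalized kernel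 $\hat k_{(i,j)}=\frac{1}{\sqrt2}(e_i,e_j)$. For a $2\times2$ block matrix $M$ with $n\times n$ blocks, acting on $\mathbb{C}^n\oplus\mathbb{C}^n$, $\mathbf{ber}(M)=\max_{i,j}|\langle M\hat k_{(i,j)},\hat k_{(i,j)}\rangle|$. $\mathbf{ber}^p(T)$ means $(\mathbf{ber}(T))^p$. *)

(* Defs.v *)
From mathcomp Require Import all_boot all_order all_algebra.
From mathcomp Require Import spectral sesquilinear complex.
From mathcomp Require Import boolp classical_sets reals.

Set Implicit Arguments.
Unset Strict Implicit.
Unset Printing Implicit Defensive.

Import Order.TTheory GRing.Theory Num.Theory.
Local Open Scope ring_scope.
Local Open Scope sesquilinear_scope.
Local Open Scope complex_scope.

Section Matrices.
Variable R : realType.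
Local Notation C := R[i].

(* The standard inner product of C^n, linear in its first argument; [dotmx] is
   stated for row vectors, whereas matrices act here on column vectors. *)
Definition inner n (x y : 'cV[C]_n) : C := dotmx x^T y^T.

Definition psdmx n (A : 'M[C]_n) : Prop := forall x : 'cV[C]_n, 0 <= inner (A *m x) x.

(* |T|, the positive semidefinite square root of T^* T; the default value 0 is
   never used, see [absmxP]. *)
Definition absmx n (T : 'M[C]_n) : 'M[C]_n :=
  xget 0 [set A : 'M[C]_n | psdmx A /\ A ^+ 2 = T^t* *m T]%classic.

(* The four Penrose equations. *)
Definition is_mpinv n (A X : 'M[C]_n) : Prop :=
  [/\ A *m X *m A = A, X *m A *m X = X,
      (A *m X)^t* = A *m X & (X *m A)^t* = X *m A].

(* The default value 0 is never used: the Moore-Penrose inverse exists and is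
   unique, see [mpinvP] and [mpinv_uniq]. *)
Definition mpinv n (A : 'M[C]_n) : 'M[C]_n :=
  xget 0 [set X : 'M[C]_n | is_mpinv A X]%classic.

(* The Berezin number and the Berezin norm of a matrix with respect to a finite
   family k of normalized reproducing kernels; all the terms are nonnegative,
   so that 0 is a neutral initial value for the maximum. [Normc.normc] is the
   modulus with values in R, whereas [`|z|] is in R[i]. *)
Definition berezin_number m (I : finType) (k : I -> 'cV[C]_m) (A : 'M[C]_m) : R :=
  \big[Num.max/0]_(i : I) Normc.normc (inner (A *m k i) (k i)).

Definition berezin_norm m (I : finType) (k : I -> 'cV[C]_m) (A : 'M[C]_m) : R :=
  \big[Num.max/0]_(i : I) \big[Num.max/0]_(j : I)
    Normc.normc (inner (A *m k i) (k j)).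

Definition stdker n (i : 'I_n) : 'cV[C]_n := delta_mx i 0.

(* The normalized kernel of C^n (+) C^n at (i, j). *)
Definition sumker n (ij : 'I_n * 'I_n) : 'cV[C]_(n + n) :=
  ((Num.sqrt 2)^-1)%:C *: col_mx (stdker ij.1) (stdker ij.2).

Definition ber n (A : 'M[C]_n) : R := berezin_number (@stdker n) A.
Definition bernorm n (A : 'M[C]_n) : R := berezin_norm (@stdker n) A.
Definition ber2 n (M : 'M[C]_(n + n)) : R := berezin_number (@sumker n) M.

Lemma innerE n (x y : 'cV[C]_n) : inner x y = (y^t* *m x) 0 0.
Proof.
rewrite /inner dotmxE !mxE; apply: eq_bigr => i _.
by rewrite !mxE mulrC.
Qed.

Lemma adjM n p q (A : 'M[C]_(n, p)) (B : 'M[C]_(p, q)) :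
  (A *m B)^t* = B^t* *m A^t*.
Proof. by rewrite trmx_mul map_mxM. Qed.

Lemma inner_adjM n m (A : 'M[C]_(m, n)) (x : 'cV[C]_n) (y : 'cV[C]_m) :
  inner (A *m x) y = inner x (A^t* *m y).
Proof. by rewrite !innerE adjM trmxCK mulmxA. Qed.

Lemma inner_ge0 n (x : 'cV[C]_n) : 0 <= inner x x.
Proof.
rewrite innerE mxE sumr_ge0// => i _.
by rewrite !mxE mulrC mul_conjC_ge0.
Qed.

Lemma inner_eq0 n (x : 'cV[C]_n) : inner x x = 0 -> x = 0.
Proof.
rewrite innerE mxE => /psumr_eq0P h; apply/colP => i; rewrite [RHS]mxE.
have h0 j : true -> 0 <= (x^t*) 0 j * x j 0.
  by rewrite !mxE mulrC mul_conjC_ge0.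
by move/eqP: (h h0 i isT); rewrite !mxE mulrC mul_conjC_eq0 => /eqP.
Qed.

Lemma adjM_eq0 n p (A : 'M[C]_(n, p)) : A^t* *m A = 0 -> A = 0.
Proof.
move=> h; apply/matrixP => i j.
have : A *m delta_mx j 0 = 0 :> 'cV_n.
  by apply: inner_eq0; rewrite inner_adjM mulmxA h mul0mx innerE trmx0 map_mx0
    mul0mx mxE.
by move/colP/(_ i); rewrite -colE !mxE.
Qed.

Lemma gram_spectral n (T : 'M[C]_n) : exists U : 'M[C]_n, exists d : 'rV[C]_n,
  [/\ U \is unitarymx, forall i, 0 <= d 0 i & T^t* *m T = U^t* *m diag_mx d *m U].
Proof.
set G := T^t* *m T.
have GH : G^t* = G by rewrite /G adjM trmxCK.
have /orthomx_spectralP : G \is normalmx by apply/normalmxP; rewrite GH.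
rewrite invmx_unitary ?spectral_unitarymx//.
set U := spectralmx G; set d := spectral_diag G => GE.
have Uu : U \is unitarymx by exact: spectral_unitarymx.
exists U, d; split => // i.
have -> : d 0 i = inner (G *m (U^t* *m delta_mx i 0)) (U^t* *m delta_mx i 0).
  rewrite -inner_adjM innerE.
  have -> : U *m (G *m (U^t* *m delta_mx i 0)) = diag_mx d *m delta_mx i 0 :> 'cV_n.
    rewrite GE !mulmxA (unitarymxP Uu) mul1mx.
    by rewrite -!mulmxA (mulmxA U) (unitarymxP Uu) mul1mx.
  rewrite -colE mxE (bigD1 i)//= big1 ?addr0 => [|j ji].
    by rewrite !mxE !eqxx conjC1 mul1r mulr1n.
  by rewrite !mxE (negbTE ji) conjC0 mul0r.
by rewrite /G -mulmxA inner_adjM trmxCK inner_ge0.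
Qed.

Lemma absmxP n (T : 'M[C]_n) : psdmx (absmx T) /\ absmx T ^+ 2 = T^t* *m T.
Proof.
pose S := [set A : 'M[C]_n | psdmx A /\ A ^+ 2 = T^t* *m T]%classic.
suff : S (absmx T) by [].
apply: xgetPex; rewrite {}/S /=.
have [U [d [Uu d0 TE]]] := gram_spectral T.
pose r : 'rV[C]_n := \row_i sqrtC (d 0 i).
exists (U^t* *m diag_mx r *m U); split.
  move=> x; rewrite -!mulmxA inner_adjM trmxCK innerE mxE sumr_ge0// => i _.
  rewrite mul_diag_mx !mxE mulrCA mulr_ge0 ?sqrtC_ge0 //.
  by rewrite mulrC mul_conjC_ge0.
rewrite expr2 -mulmxE !mulmxA mulmxtVK// TE; congr (_ *m _).
rewrite -mulmxA mulmx_diag; congr (_ *m diag_mx _).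
by apply/rowP => i; rewrite !mxE -expr2 sqrtCK.
Qed.

Lemma mpinvP n (A : 'M[C]_n) : is_mpinv A (mpinv A).
Proof.
suff : [set X | is_mpinv A X]%classic (mpinv A) by [].
apply: xgetPex => /=.
have [U [d [Uu d0]]] := gram_spectral A.
set G := A^t* *m A => GE.
pose r : 'rV[C]_n := \row_i (d 0 i)^-1.
pose H := U^t* *m diag_mx r *m U.
have UDU (a b : 'rV[C]_n) :
    (U^t* *m diag_mx a *m U) *m (U^t* *m diag_mx b *m U) =
    U^t* *m diag_mx (\row_i (a 0 i * b 0 i)) *m U.
  by rewrite !mulmxA mulmxtVK// -(mulmxA _ (diag_mx a)) mulmx_diag.
have adjUDU (a : 'rV[C]_n) : (forall i, 0 <= a 0 i) ->
    (U^t* *m diag_mx a *m U)^t* = U^t* *m diag_mx a *m U.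
  move=> a0; rewrite !adjM trmxCK mulmxA; congr (_ *m _ *m _).
  apply/matrixP => i j; rewrite !mxE eq_sym.
  by case: eqP => [->|_]; rewrite ?mulr0n ?conjC0// mulr1n geC0_conj.
have HH : H^t* = H by apply: adjUDU => i; rewrite mxE invr_ge0.
have HG : H *m G = G *m H.
  by rewrite GE !UDU; congr (_ *m diag_mx _ *m _); apply/rowP => i;
    rewrite !mxE mulrC.
have GHG : G *m H *m G = G.
  rewrite GE !UDU; congr (_ *m diag_mx _ *m _); apply/rowP => i; rewrite !mxE.
  by have [->|d1] := eqVneq (d 0 i) 0; rewrite ?mulr0// mulfV// mul1r.
have HGH : H *m G *m H = H.
  rewrite GE !UDU; congr (_ *m diag_mx _ *m _); apply/rowP => i; rewrite !mxE.
  by have [->|d1] := eqVneq (d 0 i) 0; rewrite ?invr0 ?mulr0// mulVf// mul1r.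
clearbody H.
have GG : G^t* = G by rewrite adjM trmxCK.
exists (H *m A^t*); split.
- apply/eqP; rewrite -subr_eq0; apply/eqP/adjM_eq0.
  rewrite -!mulmxA -/G.
  rewrite (_ : A *m (H *m G) - A = A *m (H *m G - 1%:M)); last first.
    by rewrite mulmxBr mulmx1.
  rewrite adjM -mulmxA (mulmxA (A^t*)) -/G mulmxBr mulmx1 (mulmxA G) GHG subrr.
  by rewrite mulmx0.
- by rewrite -(mulmxA H) -/G mulmxA HGH.
- by rewrite !adjM trmxCK HH mulmxA.
- by rewrite -mulmxA -/G adjM HH GG HG.
Qed.

Lemma mpinv_uniq n (A X : 'M[C]_n) : is_mpinv A X -> X = mpinv A.
Proof.
have [] := mpinvP A; set Y := mpinv A => b1 b2 b3 b4 [a1 a2 a3 a4].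
have XA : X *m A = Y *m A.
  rewrite -[in LHS]b1 -mulmxA !mulmxA -(mulmxA (X *m A)) -a4 -b4 -adjM.
  by rewrite -!mulmxA (mulmxA A X) a1 b4.
have AX : A *m X = A *m Y.
  rewrite -[in LHS]b1 -(mulmxA (A *m Y)) -a3 -b3 -adjM.
  by rewrite !mulmxA a1 b3.
by rewrite -a2 -mulmxA AX mulmxA XA b2.
Qed.

End Matrices.

(* Main.v *)
Require Import Defs.
From mathcomp Require Import all_boot all_order all_algebra.
From mathcomp Require Import spectral sesquilinear complex reals lra.


(** Fix a normalized kernel x at (i, j), that is (e_i, e_j) / sqrt 2, and split the
    block matrix as D + B, where D = diag (S, T) and B has the off-diagonal
    blocks P and Q. With a = |<D x, x>| and b = |<B x, x>|, the quantity to be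
    bounded is at most (a + b)^2 = a^2 + a (2 b) + b^2, and each of the three
    terms gives one part of the right-hand side.

    - <D x, x> is the mean of <S e_i, e_i> and <T e_j, e_j>, so that a is at most
      max (ber S, ber T) ([modulus_diag_sumker]).

    - 2 b is at most |<P e_j, e_i>| + |<Q e_i, e_j>|. The matrix
      K = P (|P|^2)^+ P^* is the orthogonal projection onto the range of P
      ([rangeproj_mpinv]), hence <P e_j, e_i> = <P e_j, K e_i>, and
      2 |<u, v>| <= |u|^2 + |v|^2 ([inner_amgm]) bounds its modulus by the mean of
      <|P|^2 e_j, e_j> and <K e_i, e_i>. The term with Q is treated in the same way,
      and grouping the four quadratic forms by index, e_i or e_j, gives
      [modulus_offdiag_sumker].

    - b^2 is bounded by Buzano's inequality applied to B x and B^* x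
      ([buzano_mx]): B^2 is diag (P Q, Q P), while |B x|^2 + |B^* x|^2 is half the
      sum of the values at e_i and at e_j of the quadratic forms of
      |Q|^2 + |P^*|^2 and of |P|^2 + |Q^*|^2 ([modulus_offdiag_sumker_sqr]).

    [ber2D_sqr_le] takes the maximum over all kernels. Cauchy-Schwarz is only
    needed in its arithmetic-geometric form, so that squared norms suffice
    throughout. *)

Set Implicit Arguments.
Unset Strict Implicit.
Unset Printing Implicit Defensive.

Import Order.TTheory GRing.Theory Num.Theory.
Local Open Scope ring_scope.
Local Open Scope sesquilinear_scope.

(** * Inner products and Buzano's inequality *)

Section InnerProduct.
Variable R : realType.
Local Notation C := R[i].

(** [Normc.normc] with codomain R itself, so that the ordered field structure of
    R applies to its values. *)
Definition modulus (z : C) : R := Normc.normc z.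

Lemma modulusE (z : C) : ((modulus z)%:C)%C = `|z|.
Proof. by []. Qed.

Lemma modulus_real (r : R) : 0 <= r -> modulus (r%:C)%C = r.
Proof.
by move=> r0; rewrite /modulus /Normc.normc /= expr0n addr0 sqrtr_sqr ger0_norm.
Qed.

Lemma modulus_ge0 (z : C) : 0 <= modulus z.
Proof. by rewrite -lecR modulusE normr_ge0. Qed.

Lemma modulusD (x y : C) : modulus (x + y) <= modulus x + modulus y.
Proof. exact: le_normcD. Qed.

Lemma modulusM (x y : C) : modulus (x * y) = modulus x * modulus y.
Proof. exact: Normc.normcM. Qed.

Section Vectors.
Variable n : nat.
Implicit Types (a b x y : 'cV[C]_n) (c : C).

Lemma innerDl a b y : inner (a + b) y = inner a y + inner b y.
Proof. by rewrite !innerE mulmxDr mxE. Qed.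

Lemma inner0l y : inner 0 y = 0.
Proof. by rewrite innerE mulmx0 mxE. Qed.

Lemma innerZl c a y : inner (c *: a) y = c * inner a y.
Proof. by rewrite !innerE -scalemxAr mxE. Qed.

Lemma inner_conj a b : inner b a = (inner a b)^*.
Proof.
rewrite /inner !dotmxE !mxE rmorph_sum; apply: eq_bigr => i _.
by rewrite !mxE (rmorphM (@Num.conj C)) /= conjCK mulrC.
Qed.

Lemma innerDr a b y : inner y (a + b) = inner y a + inner y b.
Proof. by rewrite !innerE linearD map_mxD mulmxDl mxE. Qed.

Lemma innerZr c a y : inner y (c *: a) = c^* * inner y a.
Proof. by rewrite !innerE linearZ map_mxZ -scalemxAl mxE. Qed.

Definition normsq x : R := modulus (inner x x).

Lemma inner_normsq x : inner x x = ((normsq x)%:C)%C.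
Proof. by rewrite modulusE ger0_norm ?inner_ge0. Qed.

Lemma normsq_ge0 x : 0 <= normsq x.
Proof. by rewrite -ler0c -inner_normsq inner_ge0. Qed.

(** The sum over the coordinates of 2 |a_k| |b_k| <= |a_k|^2 + |b_k|^2. *)
Lemma inner_amgm a b : 2 * modulus (inner a b) <= normsq a + normsq b.
Proof.
have amgm : `|inner a b| + `|inner a b| <= inner a a + inner b b.
  rewrite /inner !dotmxE !mxE -big_split /=.
  apply: le_trans (lerD (ler_norm_sum _ _ _) (ler_norm_sum _ _ _)) _.
  rewrite -big_split /=; apply: ler_sum => i _.
  rewrite !mxE normrM norm_conjC -!normCK -mulr2n -mulr_natr.
  rewrite -ler_pdivlMr; last exact: (ltr0n _ 2).
  exact: (real_leif_mean_square (normr_real _) (normr_real _)).1.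
have transfer (m p q : R) : m%:C%C + m%:C%C <= p%:C%C + q%:C%C -> 2 * m <= p + q.
  rewrite -!(rmorphD (real_complex R)) lecR; clear; lra.
apply: transfer; move: amgm; rewrite (inner_normsq a) (inner_normsq b).
exact.
Qed.

(** For a unit vector x, the reflection a |-> 2 <a, x> x - a is an isometry, and
    2 <a, x> <x, b> = <r, b> + <a, b> where r is the image of a; it remains to apply
    [inner_amgm] to r and b. *)
Lemma buzano a b x : inner x x = 1 ->
  4 * modulus (inner a x * inner x b) <= normsq a + normsq b + 2 * modulus (inner a b).
Proof.
move=> x1; pose r := (2 * inner a x) *: x + (-1) *: a.
have rE : normsq r = normsq a.
  suff e : inner r r = inner a a.
    exact: complexI (etrans (esym (inner_normsq r)) (etrans e (inner_normsq a))).
  rewrite /r !(innerDl, innerDr, innerZl, innerZr) x1 (inner_conj a x).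
  rewrite (rmorphM (@Num.conj C)) (rmorphN (@Num.conj C)) (rmorph1 (@Num.conj C)) /=.
  rewrite (conjC_nat _ 2).
  move: (inner a x) (inner a a) => c w; move: (c^*) => c'.
  rewrite mulr1 !mulN1r opprK mulrN.
  have -> : 2 * c' - c' = c' by rewrite mulr_natl mulr2n addrK.
  by rewrite mulrAC addrA subrr add0r.
have e : 2 * (inner a x * inner x b) = inner r b + inner a b.
  by rewrite /r innerDl !innerZl mulN1r subrK mulrA.
have m2 : modulus (2 : C) = 2.
  by rewrite -[2 in LHS](rmorph_nat (real_complex R) 2) modulus_real.
have tri : 2 * modulus (inner a x * inner x b) <= modulus (inner r b) + modulus (inner a b).
  by rewrite -{1}m2 -modulusM e; apply: modulusD.
have amgm : 2 * modulus (inner r b) <= normsq a + normsq b.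
  by rewrite -rE; apply: inner_amgm.
have arith (u v w s : R) : 2 * u <= s -> 2 * w <= u + v -> 4 * w <= s + 2 * v.
  by clear; lra.
exact: arith amgm tri.
Qed.

(** Buzano's inequality for A x and A^* x: both factors on its left-hand side are
    then <A x, x>, and the inner product of the two vectors is <A^2 x, x>. *)
Lemma buzano_mx (A : 'M[C]_n) x : inner x x = 1 ->
  4 * modulus (inner (A *m x) x) ^+ 2 <=
  normsq (A *m x) + normsq (A^t* *m x) + 2 * modulus (inner (A *m A *m x) x).
Proof.
move=> /(buzano (A *m x) (A^t* *m x)).
by rewrite -!inner_adjM modulusM -expr2 mulmxA.
Qed.

End Vectors.

(** * The projection onto the range of a matrix *)

(** P (P^* P)^+ P^* is the orthogonal projection onto the range of P. It is
    Hermitian because the Moore-Penrose inverse of a Hermitian matrix is, by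
    uniqueness, and it fixes P because P Y = 0 as soon as P^* P Y = 0. *)
Lemma rangeproj_mpinv n (P : 'M[C]_n) (K := P *m mpinv (P^t* *m P) *m P^t*) :
  [/\ K^t* = K, K *m K = K & K *m P = P].
Proof.
rewrite /K {K}; set G := P^t* *m P; set X := mpinv G.
have GH : G^t* = G by rewrite adjM trmxCK.
have [] := mpinvP G; rewrite -/X => GXG XGX GXH XGH.
have XH : X^t* = X.
  (* The adjoint of X satisfies the Penrose equations of the Hermitian G. *)
  apply: mpinv_uniq; rewrite -/X; split.
  - by rewrite -{1 2 3}GH -!adjM mulmxA GXG.
  - by rewrite -{1}GH -!adjM mulmxA XGX.
  - by rewrite -{1 2}GH -!adjM XGH.
  - by rewrite -{1 2}GH -!adjM GXH.
split; first by rewrite !adjM trmxCK XH mulmxA.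
  by rewrite !mulmxA -(mulmxA (P *m X)) -/G -(mulmxA P X) -(mulmxA P) XGX.
rewrite -mulmxA -/G; apply/eqP; rewrite -subr_eq0; apply/eqP/adjM_eq0.
have -> : P *m X *m G - P = P *m (X *m G - 1%:M) by rewrite mulmxBr mulmx1 (mulmxA P X).
by rewrite adjM -mulmxA (mulmxA (P^t*)) -/G mulmxBr mulmx1 (mulmxA G X) GXG subrr mulmx0.
Qed.

(** <P x, y> = <P x, K y> whenever K is Hermitian and fixes P; replacing y by K y
    is what brings the range projection into the bound. *)
Lemma inner_fixedproj n (P K : 'M[C]_n) (x y : 'cV[C]_n) :
  K^t* = K -> K *m P = P ->
  2 * modulus (inner (P *m x) y) <= normsq (P *m x) + normsq (K *m y).
Proof.
move=> KH KP; rewrite -{1}KP -mulmxA inner_adjM KH; exact: inner_amgm.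
Qed.

Lemma qform_normsq n (A B : 'M[C]_n) (x : 'cV[C]_n) :
  modulus (inner ((A^t* *m A + B^t* *m B) *m x) x) = normsq (A *m x) + normsq (B *m x).
Proof.
have e : inner ((A^t* *m A + B^t* *m B) *m x) x
    = ((normsq (A *m x) + normsq (B *m x))%:C)%C.
  rewrite mulmxDl innerDl -!mulmxA (inner_adjM (A^t*)) (inner_adjM (B^t*)) !trmxCK.
  by rewrite (rmorphD (real_complex R)) (inner_normsq (A *m x)) (inner_normsq (B *m x)).
by rewrite e; apply: modulus_real; rewrite addr_ge0 ?normsq_ge0.
Qed.

(** * Normalized kernels of the direct sum *)

Lemma inner_col_mx m n (a c : 'cV[C]_m) (b d : 'cV[C]_n) :
  inner (col_mx a b) (col_mx c d) = inner a c + inner b d.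
Proof. by rewrite !innerE tr_col_mx map_row_mx mul_row_col mxE. Qed.

Local Notation e i := (stdker R i).

Lemma inner_stdker n (i : 'I_n) : inner (e i) (e i) = 1.
Proof.
rewrite innerE mxE (bigD1 i)//= big1 ?addr0 => [|j ji].
  by rewrite !mxE !eqxx conjC1 mul1r.
by rewrite !mxE (negbTE ji) conjC0 mul0r.
Qed.

Lemma inner_scale_sqrt2 m (u v : 'cV[C]_m) :
  inner (((Num.sqrt 2)^-1 : R)%:C%C *: u) (((Num.sqrt 2)^-1 : R)%:C%C *: v)
  = (2^-1 : R)%:C%C * inner u v.
Proof.
rewrite innerZl innerZr mulrA; congr (_ * _).
have -> : (((Num.sqrt 2)^-1 : R)%:C%C)^* = ((Num.sqrt 2)^-1 : R)%:C%C.
  by rewrite geC0_conj// ler0c invr_ge0 sqrtr_ge0.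
by rewrite -(rmorphM (real_complex R)) -invfM -expr2 sqr_sqrtr.
Qed.

Lemma inner_sumker n (A B D E : 'M[C]_n) i j :
  inner (block_mx A B D E *m sumker R (i, j)) (sumker R (i, j)) =
  (2^-1 : R)%:C%C * (inner (A *m e i) (e i) + inner (B *m e j) (e i)
                     + (inner (D *m e i) (e j) + inner (E *m e j) (e j))).
Proof.
rewrite /sumker -scalemxAr inner_scale_sqrt2 mul_block_col inner_col_mx /=.
by rewrite !innerDl.
Qed.

Lemma normsq_sumker n (P Q : 'M[C]_n) i j :
  normsq (block_mx 0 P Q 0 *m sumker R (i, j)) =
  2^-1 * (normsq (P *m e j) + normsq (Q *m e i)).
Proof.
set x := block_mx _ _ _ _ *m _; set a := P *m _; set b := Q *m _.
have half (u v : R) : (2^-1 * (u + v))%:C%C = (2^-1 : R)%:C%C * (u%:C%C + v%:C%C).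
  by rewrite (rmorphM (real_complex R)) (rmorphD (real_complex R)).
have xE : inner x x = (2^-1 : R)%:C%C * (inner a a + inner b b).
  rewrite /x /sumker -scalemxAr inner_scale_sqrt2 mul_block_col inner_col_mx /=.
  by rewrite !mul0mx add0r addr0.
rewrite (inner_normsq a) (inner_normsq b) -half in xE.
exact: complexI (etrans (esym (inner_normsq x)) xE).
Qed.

Lemma unit_sumker n (i j : 'I_n) : inner (sumker R (i, j)) (sumker R (i, j)) = 1.
Proof.
rewrite /sumker inner_scale_sqrt2 inner_col_mx /= !inner_stdker.
rewrite -(rmorph1 (real_complex R)) -(rmorphD (real_complex R)).
by rewrite -(rmorphM (real_complex R)) mulVf// (pnatr_eq0 R 2).
Qed.

Lemma ber_ge n (A : 'M[C]_n) i : modulus (inner (A *m e i) (e i)) <= ber A.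
Proof. exact: le_bigmax. Qed.

Lemma ber_ge0 n (A : 'M[C]_n) : 0 <= ber A.
Proof. exact: bigmax_ge_id. Qed.

Lemma bernorm_ge n (A : 'M[C]_n) i : modulus (inner (A *m e i) (e i)) <= bernorm A.
Proof. by apply: le_trans (le_bigmax _ _ i); apply: le_bigmax. Qed.

Lemma bernorm_ge0 n (A : 'M[C]_n) : 0 <= bernorm A.
Proof. exact: bigmax_ge_id. Qed.

Lemma modulus_half (z : C) : modulus ((2^-1 : R)%:C%C * z) = 2^-1 * modulus z.
Proof. by rewrite modulusM modulus_real ?invr_ge0. Qed.

Lemma half_max (a b x y : R) : x <= a -> y <= b -> 2^-1 * (x + y) <= Num.max a b.
Proof.
move=> xa yb; have a_max : a <= Num.max a b by rewrite le_max lexx.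
have b_max : b <= Num.max a b by rewrite le_max lexx orbT.
move: (Num.max a b) a_max b_max => m; lra.
Qed.

(** * Bounds at a single kernel *)

Lemma max_ge0 (x y : R) : 0 <= x -> 0 <= Num.max x y.
Proof. by move=> x0; rewrite le_max x0. Qed.

Lemma sqr_max (x y : R) : Num.max x y ^+ 2 <= Num.max (x ^+ 2) (y ^+ 2).
Proof. by case: (leP x y) => _; rewrite le_max lexx ?orbT. Qed.

Lemma modulus_diag_sumker n (S T : 'M[C]_n) i j :
  modulus (inner (block_mx S 0 0 T *m sumker R (i, j)) (sumker R (i, j)))
  <= Num.max (ber S) (ber T).
Proof.
rewrite inner_sumker modulus_half !mul0mx !inner0l addr0 add0r.
 apply: le_trans (half_max (ber_ge S i) (ber_ge T j)).
by rewrite ler_wpM2l ?invr_ge0 // modulusD.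
Qed.

(** [inner_fixedproj] bounds the P term by forms at e_j for P and at e_i for K, and
    the Q term by forms at e_i for Q and at e_j for L. Grouping the forms by
    index pairs Q with K and P with L, and an orthogonal projection satisfies
    K = K^* K, so that each pair is the quadratic form of one matrix. *)
Lemma modulus_offdiag_sumker n (P Q K L : 'M[C]_n) i j :
  [/\ K^t* = K, K *m K = K & K *m P = P] ->
  [/\ L^t* = L, L *m L = L & L *m Q = Q] ->
  2 * modulus (inner (block_mx 0 P Q 0 *m sumker R (i, j)) (sumker R (i, j)))
  <= Num.max (ber (Q^t* *m Q + K)) (ber (P^t* *m P + L)).
Proof.
move=> [KH KK KP] [LH LL LQ].
rewrite inner_sumker modulus_half !mul0mx !inner0l add0r addr0.
have leP := inner_fixedproj (e j) (e i) KH KP.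
have leQ := inner_fixedproj (e i) (e j) LH LQ.
have bi : normsq (Q *m e i) + normsq (K *m e i) <= ber (Q^t* *m Q + K).
  by rewrite -qform_normsq KH KK ber_ge.
have bj : normsq (P *m e j) + normsq (L *m e j) <= ber (P^t* *m P + L).
  by rewrite -qform_normsq LH LL ber_ge.
apply: le_trans (half_max bi bj).
have tri := modulusD (inner (P *m e j) (e i)) (inner (Q *m e i) (e j)).
have arith (m p q u v w z : R) : m <= p + q -> 2 * p <= u + v -> 2 * q <= w + z ->
    2 * (2^-1 * m) <= 2^-1 * (w + v + (u + z)) by clear; lra.
exact: arith tri leP leQ.
Qed.

(** [buzano_mx] for the off-diagonal block matrix, whose adjoint and square are
    again off-diagonal and diagonal block matrices. *)
Lemma modulus_offdiag_sumker_sqr n (P Q : 'M[C]_n) i j :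
  modulus (inner (block_mx 0 P Q 0 *m sumker R (i, j)) (sumker R (i, j))) ^+ 2
  <= 1 / 4 * Num.max (bernorm (absmx Q ^+ 2 + absmx (P^t*) ^+ 2))
                     (bernorm (absmx P ^+ 2 + absmx (Q^t*) ^+ 2))
     + 1 / 2 * Num.max (ber (P *m Q)) (ber (Q *m P)).
Proof.
have adj : (block_mx 0 P Q 0)^t* = block_mx 0 (Q^t*) (P^t*) 0.
  by rewrite tr_block_mx map_block_mx !trmx0 !map_mx0.
have sqr : block_mx 0 P Q 0 *m block_mx 0 P Q 0 = block_mx (P *m Q) 0 0 (Q *m P).
  by rewrite mulmx_block !mul0mx !mulmx0 !add0r !addr0.
have buz := buzano_mx (block_mx 0 P Q 0) (unit_sumker i j).
rewrite adj sqr (normsq_sumker P Q) (normsq_sumker (Q^t*) (P^t*)) in buz.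
have diag := modulus_diag_sumker (P *m Q) (Q *m P) i j.
rewrite (absmxP P).2 (absmxP Q).2 (absmxP (P^t*)).2 (absmxP (Q^t*)).2.
have bi := bernorm_ge (Q^t* *m Q + P^t*^t* *m P^t*) i.
have bj := bernorm_ge (P^t* *m P + Q^t*^t* *m Q^t*) j.
rewrite (qform_normsq Q (P^t*)) in bi; rewrite (qform_normsq P (Q^t*)) in bj.
have norms := half_max bi bj.
have arith (m p q u v w z B : R) :
    4 * m <= 2^-1 * (u + v) + 2^-1 * (w + z) + 2 * B -> B <= q ->
    2^-1 * (v + z + (u + w)) <= p -> m <= 1 / 4 * p + 1 / 2 * q by clear; lra.
exact: arith buz diag norms.
Qed.

(** The three summands of (a + b)^2 are bounded separately at every kernel, and
    the maximum is then taken by comparing with the square root of the bound.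
    The nonnegativity hypotheses cover the case where there is no kernel, n = 0. *)
Lemma ber2D_sqr_le n (A B : 'M[C]_(n + n)) (m s w z : R) :
  0 <= m -> m ^+ 2 <= s -> 0 <= w -> 0 <= z ->
  (forall x, modulus (inner (A *m sumker R x) (sumker R x)) <= m) ->
  (forall x, 2 * modulus (inner (B *m sumker R x) (sumker R x)) <= w) ->
  (forall x, modulus (inner (B *m sumker R x) (sumker R x)) ^+ 2 <= z) ->
  ber2 (A + B) ^+ 2 <= s + m * w + z.
Proof.
move=> m0 ms w0 z0 Am Bw Bz.
have rhs0 : 0 <= s + m * w + z by rewrite !addr_ge0 ?mulr_ge0 ?(le_trans _ ms) ?sqr_ge0.
suff le_sqrt : ber2 (A + B) <= Num.sqrt (s + m * w + z).
  rewrite -(sqr_sqrtr rhs0) ler_pXn2r ?nnegrE ?sqrtr_ge0//.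
  exact: bigmax_ge_id.
apply: bigmax_le => [|x _]; first exact: sqrtr_ge0.
rewrite -/(modulus _) mulmxDl innerDl.
have arith (v a b : R) : 0 <= v -> 0 <= a -> 0 <= b ->
    v <= a + b -> a <= m -> 2 * b <= w -> b ^+ 2 <= z ->
    v <= Num.sqrt (s + m * w + z).
  move=> v0 a0 b0 vab am bw bz.
  rewrite -(ger0_norm v0) -sqrtr_sqr ler_sqrt//.
  have v2 : v ^+ 2 <= (a + b) ^+ 2 by rewrite ler_pXn2r ?nnegrE ?addr_ge0.
  apply: (le_trans v2); rewrite sqrrD; apply: lerD => //; apply: lerD.
    by apply: le_trans ms; rewrite ler_pXn2r ?nnegrE.
  by rewrite -mulr_natl mulrCA ler_pM ?mulr_ge0 ?ler0n.
exact: arith (modulus_ge0 _) (modulus_ge0 _) (modulus_ge0 _) (modulusD _ _)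
  (Am x) (Bw x) (Bz x).
Qed.

End InnerProduct.

(** * The bound for block matrices *)

Theorem corollary3p8 (R : realType) (n : nat) (S T P Q : 'M[R[i]]_n) :
  ber2 (block_mx S P Q T) ^+ 2 <=
    Num.max (ber S ^+ 2) (ber T ^+ 2)
    + Num.max (ber S) (ber T)
      * Num.max
          (ber (absmx Q ^+ 2 + P *m mpinv (absmx P ^+ 2) *m P^t*))
          (ber (absmx P ^+ 2 + Q *m mpinv (absmx Q ^+ 2) *m Q^t*))
    + 1 / 4 * Num.max (bernorm (absmx Q ^+ 2 + absmx (P^t*) ^+ 2))
                      (bernorm (absmx P ^+ 2 + absmx (Q^t*) ^+ 2))
    + 1 / 2 * Num.max (ber (P *m Q)) (ber (Q *m P)).
Proof.
have block_split : block_mx S P Q T = block_mx S 0 0 T + block_mx 0 P Q 0.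
  by rewrite add_block_mx !addr0 !add0r.
rewrite block_split -addrA.
apply: ber2D_sqr_le.
- exact: max_ge0 (ber_ge0 S).
- exact: sqr_max.
- exact: max_ge0 (ber_ge0 _).
- apply: addr_ge0; apply: mulr_ge0; rewrite ?divr_ge0 ?ler0n//.
    exact: max_ge0 (bernorm_ge0 _).
  exact: max_ge0 (ber_ge0 _).
- by case=> i j; apply: modulus_diag_sumker.
- case=> i j; rewrite (absmxP P).2 (absmxP Q).2.
  exact: modulus_offdiag_sumker (rangeproj_mpinv P) (rangeproj_mpinv Q).
- by case=> i j; apply: modulus_offdiag_sumker_sqr.
Qed.
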